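(* Let $1 \leq J \leq N$ and $M \geq 1$ be integers, and let $\Omega \subseteq \mathbb{Z}^N$ be a sublattice of rank $J$. Let $\Lambda_1,\dots,\Lambda_M$ be non-zero sublattices of $\Omega$ whose ranks $l_1,\dots,l_M$ satisfy $1 \leq l_i \leq J-1$ for each $1 \leq i \leq M$. Then there exists $\boldsymbol{x} \in \Omega \setminus \bigcup_{i=1}^M \Lambda_i$ such that $$H(\boldsymbol{x}) \leq \left( \left( \frac{3}{2} \right)^{J-1} J^J \left\{ \sum_{i=1}^M \frac{1}{H(\Lambda_i)} + \sqrt{M} \right\} + J \right) H(\Omega).$$
   Context: For $\boldsymbol{x}=(x_1,\dots,x_N)\in\mathbb{Z}^N$, the height is $H(\boldsymbol{x})=\max_{1\leq i\leq N}|x_i|$. A lattice (sublattice) of rank $J$ in $\mathbb{Z}^N$ is a subgroup of $\mathbb{Z}^N$ that is free of rank $J$. For a lattice $\Lambda\subseteq\mathbb{Z}^N$ of rank $J$, $1\leq J\leq N$, choose a $\mathbb{Z}$-basis $\boldsymbol{x}_1,\dots,\boldsymbol{x}_J$ and let $X=(\boldsymbol{x}_1\ \dots\ \boldsymbol{x}_J)$ be the $N\times J$ basis matrix. For each subset $I\subseteq\{1,\dots,N\}$ of cardinality $J$ let $X_I$ be the $J\times J$ submatrix formed by the rows of $X$ indexed by $I$. The height of the lattice is $H(\Lambda)=\max_{I}|\det(X_I)|$, which does not depend on the choice of basis. *)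

(* Defs.v *)
From HB Require Import structures.
From mathcomp Require Import all_boot all_order all_algebra.
From mathcomp Require Import boolp classical_sets reals.

Set Implicit Arguments.
Unset Strict Implicit.
Unset Printing Implicit Defensive.

Import Order.TTheory GRing.Theory Num.Theory.

Local Open Scope ring_scope.
Local Open Scope classical_set_scope.

Definition is_subgroup (N : nat) (L : set 'cV[int]_N) : Prop :=
  L 0 /\ forall x y, L x -> L y -> L (x - y).

Definition is_basis (N J : nat) (L : set 'cV[int]_N) (X : 'M[int]_(N, J)) :
    Prop :=
  (forall j, L (col j X)) /\
  (forall x, L x -> exists! c : 'cV[int]_J, x = \sum_j c j 0 *: col j X).

Definition is_lattice (N J : nat) (L : set 'cV[int]_N) : Prop :=
  is_subgroup L /\ exists X : 'M[int]_(N, J), is_basis L X.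

Definition vec_height (N : nat) (x : 'cV[int]_N) : nat :=
  \max_(i < N) `|x i 0%R|%N.

Definition card_set (N J : nat) := {I : {set 'I_N} | #|I| == J}.

(* The rows of X indexed by I are taken in increasing order. *)
Definition row_minor (N J : nat) (X : 'M[int]_(N, J)) (I : card_set N J) :
    'M[int]_J :=
  rowsub (fun k : 'I_J => enum_val (cast_ord (esym (eqP (valP I))) k)) X.

Definition basis_height (N J : nat) (X : 'M[int]_(N, J)) : nat :=
  \max_(I : card_set N J) `|\det (row_minor X I)|%N.

(* The height of a lattice L of rank J, computed on a basis picked by choice;
   see [basis_height_indep]; meaningful only if L has rank J. *)
Definition lattice_height (N J : nat) (L : set 'cV[int]_N) : nat :=
  basis_height (xget (0 : 'M[int]_(N, J)) [set X | is_basis L X]).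

Lemma basis_height_indep (N J : nat) (L : set 'cV[int]_N)
    (X Y : 'M[int]_(N, J)) :
  is_basis L X -> is_basis L Y -> basis_height X = basis_height Y.
Proof.
have sumE (Z : 'M[int]_(N, J)) (c : 'cV[int]_J) :
    \sum_j c j 0 *: col j Z = Z *m c.
  apply/colP => i; rewrite summxE mxE; apply: eq_bigr => j _.
  by rewrite !mxE mulrC.
have tr (Z T : 'M[int]_(N, J)) : is_basis L Z -> is_basis L T ->
    exists U : 'M[int]_J, T = Z *m U.
  move=> [_ hZ] [hT _].
  have /choice[u hu] : forall j, exists c : 'cV[int]_J, col j T = Z *m c.
    by move=> j; have [c [hc _]] := hZ _ (hT j); exists c; rewrite hc sumE.
  exists (\matrix_(i, j) u j i 0); apply/matrixP => i j.
  have /colP/(_ i) := hu j; rewrite !mxE => ->.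
  by apply: eq_bigr => k _; rewrite !mxE.
have minorM (Z : 'M[int]_(N, J)) (U : 'M[int]_J) I :
    row_minor (Z *m U) I = row_minor Z I *m U.
  by apply/matrixP => i j; rewrite !mxE; apply: eq_bigr => k _; rewrite !mxE.
move=> hX hY.
have [U YE] := tr _ _ hX hY; have [V XE] := tr _ _ hY hX.
have UV1 : U *m V = 1%:M.
  have [colX uniqX] := hX.
  apply/matrixP => i j.
  have [c [_ cU]] := uniqX _ (colX j).
  have e1 : c = col j (U *m V).
    by apply: cU; rewrite sumE !colE !mulmxA -YE -XE.
  have e2 : c = col j 1%:M by apply: cU; rewrite sumE !colE mul1mx.
  have : col j (U *m V) = col j 1%:M by rewrite -e1 -e2.
  by move/colP/(_ i); rewrite !mxE.
have U1 : `|\det U|%N = 1%N.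
  have : absz (\det U * \det V) = 1%N by rewrite -det_mulmx UV1 det1.
  by rewrite abszM => /eqP; rewrite muln_eq1 => /andP[/eqP].
rewrite YE; apply: eq_bigr => I _.
by rewrite minorM det_mulmx abszM U1 muln1.
Qed.

(* Main.v *)
(* Fix a maximal minor, with row set I, of a basis X of Omega and put
   H = H(Omega).  By Cramer's rule the sup norm of X c is at most J times that
   of X_I c, and the lattice X_I Z^J has index H in Z^J; hence for n a multiple
   of H at least n^J / H points of Omega have height at most r = J floor(n/2).
   Projecting Lambda_i of rank l on the rows of a maximal minor makes it a
   lattice of index H(Lambda_i) in Z^l, so at most
   (2r+1)^(l-1) (2r/H(Lambda_i) + 1) of its points have height at most r.  With
   B = (3/2)^(J-2) J^J H, the Lambda_i cannot contain all these points of Omega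
   once J n > B sum_i 1/H(Lambda_i) + sqrt(B M), because 2r + 1 <= (3/2) J n. *)
Require Import Defs.
From HB Require Import structures.
From mathcomp Require Import all_boot all_order all_algebra.
From mathcomp Require Import boolp classical_sets reals.
From mathcomp Require Import perm zify ring lra.

Set Implicit Arguments.
Unset Strict Implicit.
Unset Printing Implicit Defensive.

Import Order.TTheory GRing.Theory Num.Theory.

Local Open Scope ring_scope.
Local Open Scope classical_set_scope.

(** * Index of a full-rank lattice in Z^n *)

(** In the Smith normal form A = P D Q the factors [P] and [Q] are unimodular, so reducing the
    coordinates of P^-1 x modulo the invariant factors identifies Z^n / A Z^n with a product of
    cyclic groups of total order |det A|. *)
Lemma column_lattice_quotient (n : nat) (A : 'M[int]_n) : \det A != 0 ->
  exists (G : finType) (phi : 'cV[int]_n -> G),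
    [/\ #|G| = `|\det A|%N,
        forall x y, phi x = phi y <-> exists c, x - y = A *m c
      & forall g, exists x, phi x = g].
Proof.
move=> detA.
have [P uP [Q uQ [d _ AE]]] := int_Smith_normal_form A.
set Dg := (\matrix_(i, j) _) in AE.
have DgE : Dg = diag_mx (\row_i d`_i).
  by apply/matrixP => i j; rewrite !mxE.
have unit1 (U : 'M[int]_n) : U \in unitmx -> `|\det U|%N = 1%N.
  by rewrite unitmxE; case/orP => /eqP ->.
have detE : `|\det A|%N = (\prod_(i < n) absz (d`_i)%R)%N.
  rewrite AE !det_mulmx !abszM (unit1 P) // (unit1 Q) // mul1n muln1 DgE det_diag.
  rewrite (big_morph absz abszM (erefl _)).
  by apply: eq_bigr => i _; rewrite mxE.
have d0 (i : 'I_n) : d`_i != 0.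
  apply: contra detA => /eqP di; rewrite -absz_eq0 detE (bigD1 i) //=.
  by rewrite di mul0n.
(* The successor form is the ordinal type that [inord] expects; by [d0] its size is exactly the
   absolute value of the invariant factor. *)
pose T (i : 'I_n) : finType := 'I_((absz (d`_i)%R).-1.+1).
have TE (i : 'I_n) : ((absz (d`_i)%R).-1.+1 = absz (d`_i)%R)%N.
  by rewrite prednK // absz_gt0.
pose phi (x : 'cV[int]_n) : fprod T :=
  [fprod i : 'I_n => (inord `|((invmx P *m x) i 0%R %% d`_i)%Z|%N : T i)].
have mod_lt (z : int) (i : 'I_n) : (`|(z %% d`_i)%Z| < (absz (d`_i)%R).-1.+1)%N.
  rewrite TE -ltz_nat abszE ger0_norm ?modz_ge0 //; exact: ltz_mod.
have phiE x i : (phi x i : nat) = `|((invmx P *m x) i 0%R %% d`_i)%Z|%N.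
  by rewrite fprodE inordK.
exists (fprod T), phi; split.
- rewrite card_fprod detE; apply: eq_bigr => i _.
  by rewrite card_ord TE.
- move=> x y; split.
  + move=> /fprodP e.
    have dv i : (d`_i %| (invmx P *m (x - y)%R) i 0%R)%Z.
      rewrite mulmxBr !mxE -eqz_mod_dvd; apply/eqP.
      have := congr1 val (e i); rewrite /= !phiE => /(congr1 Posz).
      by rewrite !abszE !ger0_norm ?modz_ge0 // !mxE.
    pose z : 'cV[int]_n := \col_i ((invmx P *m (x - y)%R) i 0%R %/ d`_i)%Z.
    exists (invmx Q *m z); rewrite AE mulmxA mulmxK // -mulmxA.
    rewrite -[LHS](mulKVmx uP); congr (_ *m _).
    apply/colP => i; rewrite DgE mul_diag_mx !mxE mulrC.
    by rewrite divzK //; have := dv i; rewrite !mxE.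
  + move=> [c e]; apply/fprodP => i; apply: val_inj; rewrite /= !phiE.
    congr absz; apply/eqP; rewrite eqz_mod_dvd.
    have -> : (invmx P *m x) i 0 - (invmx P *m y) i 0 = (invmx P *m (x - y)) i 0.
      by rewrite mulmxBr !mxE.
    rewrite e AE -!mulmxA mulKmx // DgE mul_diag_mx !mxE.
    exact: dvdz_mulr.
- move=> g; exists (P *m \col_i (g i : nat)%:Z); apply/fprodP => i.
  apply: val_inj; rewrite /= phiE mulKmx // mxE.
  rewrite -modz_abs modz_nat absz_nat modn_small //.
  exact: leq_trans (ltn_ord (g i)) (eq_leq (TE i)).
Qed.

(** * Upper bound for lattice points in a box *)

Lemma map_uniq_inj (T U : eqType) (f : T -> U) (s : seq T) :
  uniq [seq f x | x <- s] -> {in s &, injective f}.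
Proof.
elim: s => [|z s IH] //= /andP[nz us] x y; rewrite !inE.
case/predU1P=> [->|xs] /predU1P[->|ys] //; last exact: IH.
- by move=> e; rewrite e map_f in nz.
- by move=> e; rewrite -e map_f in nz.
Qed.

Lemma vec_heightP n (x : 'cV[int]_n) r :
  reflect (forall i, (`|x i 0| <= r%:Z)) (vec_height x <= r)%N.
Proof.
apply: (iffP (bigmax_leqP _ _ _)) => [h i|h i _].
  by rewrite -abszE lez_nat h.
by rewrite -lez_nat abszE h.
Qed.

Lemma box_enum n r : exists W : seq 'cV[int]_n,
  size W = ((r.*2.+1) ^ n)%N /\ forall x, (vec_height x <= r)%N -> x \in W.
Proof.
exists [seq \col_i ((f i : nat)%:Z - r%:Z) | f : {ffun 'I_n -> 'I_(r.*2.+1)}].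
split; first by rewrite size_image card_ffun !card_ord.
move=> x /vec_heightP hx; apply/mapP.
exists [ffun i => inord (absz (x i 0 + r%:Z)%R)]; first by rewrite mem_enum.
apply/colP => i; rewrite mxE ffunE inordK; move: (x i 0) (hx i) => z hz; lia.
Qed.

(** Deleting coordinate [i] embeds a slice of the box into a box of one dimension less; slices
    measure what a box gains when moved by one unit. *)
Lemma face_enum n r (i : 'I_n.+1) (z : int) : exists W : seq 'cV[int]_n.+1,
  size W = ((r.*2.+1) ^ n)%N /\
  forall x, (vec_height x <= r)%N -> x i 0 = z -> x \in W.
Proof.
have [W [sW hW]] := box_enum n r.
exists [seq \col_k oapp (fun j => x j 0) z (unlift i k) | x : 'cV[int]_n <- W].
split; first by rewrite size_map.
move=> x /vec_heightP hx xi; apply/mapP; exists (\col_j x (lift i j) 0).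
  by apply/hW/vec_heightP => j; rewrite mxE.
by apply/colP => k; rewrite mxE; case: unliftP => [j|] -> //=; rewrite mxE.
Qed.

(** The grid Z^n is connected: [x - x0] is an integer combination of unit vectors, travelled one
    axis at a time. *)
Lemma unit_step_closed n (P : 'cV[int]_n -> Prop) :
  (exists x, P x) ->
  (forall x i (b : bool), P x -> P (x + (-1) ^+ b *: delta_mx i 0)) ->
  forall x, P x.
Proof.
move=> [x0 P0] step.
have line i x (z : int) : P x -> P (x + z *: delta_mx i 0).
  move=> Px; elim: z => [|m IH|m IH]; first by rewrite scale0r addr0.
    have := step _ i false IH; rewrite expr0 -addrA -scalerDl.
    by have -> : m%:Z + 1 = m.+1%:Z by lia.
  have := step _ i true IH; rewrite expr1 -addrA -scalerDl.
  by have -> : - m%:Z + -1 = - m.+1%:Z by lia.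
move=> x.
have -> : x = x0 + \sum_i ((x - x0) i 0) *: delta_mx i 0.
  rewrite -[LHS](subrK x0) addrC; congr (_ + _).
  rewrite [LHS]matrix_sum_delta; apply: eq_bigr => i _.
  by rewrite big_ord_recl big_ord0 addr0.
elim/big_rec: _ => [|i y _ IH]; first by rewrite addr0.
by rewrite addrCA addrC; exact: line.
Qed.

(* Adding to V a neighbour v + e of one of its points v enlarges Box + V by a
   translate of a face of the box only, so that a set V of representatives
   grown one unit step at a time satisfies
   |Box + V| <= (2r+1)^n * (2r + |V|) in dimension n + 1. *)
Lemma connected_representatives n r (G : finType) (phi : 'cV[int]_n.+1 -> G) :
  (forall x y z, phi x = phi y -> phi (x + z) = phi (y + z)) ->
  (forall g, exists x, phi x = g) ->
  forall k, (k < #|G|)%N -> exists V W : seq 'cV[int]_n.+1,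
    [/\ size V = k.+1, uniq [seq phi v | v <- V],
        (size W = (r.*2.+1) ^ n * (r.*2 + k.+1))%N
      & forall v b, v \in V -> (vec_height b <= r)%N -> b + v \in W].
Proof.
move=> phiD surj; elim=> [|k IH] kG.
  have [W [sW hW]] := box_enum n.+1 r.
  exists [:: 0], W; split=> //=; first by rewrite sW expnS addn1 mulnC.
  by move=> v b; rewrite inE => /eqP -> hb; rewrite addr0 hW.
have [V [W [sV uV sW hW]]] := IH (ltnW kG).
(* Otherwise the classes met by [V] would be closed under unit steps, hence exhaust [G], which has
   more than [size V] elements. *)
have [v [i [b [vV nV]]]] : exists v i (b : bool), v \in V /\
    phi (v + (-1) ^+ b *: delta_mx i 0) \notin [seq phi v | v <- V].
  apply: contrapT => no.
  have all_in x : phi x \in [seq phi v | v <- V].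
    apply: (unit_step_closed (P := fun x => phi x \in [seq phi v | v <- V])).
      by case: V sV {uV hW no} => // v V _; exists v; rewrite mem_head.
    move=> {}x i b /mapP[v vV /phiD ->].
    by apply: contrapT => /negP nV; apply: no; exists v, i, b.
  have : (#|G| <= size [seq phi v | v <- V])%N.
    rewrite cardE; apply: uniq_leq_size; first exact: enum_uniq.
    by move=> g _; have [x <-] := surj g.
  by rewrite size_map sV leqNgt kG.
set e := _ *: _ in nV.
(* A box point [c] leaves the box under the step [e] only from this face; elsewhere c + (v + e) = (c
   + e) + v is already in [W]. *)
have [F [sF hF]] := face_enum r i ((-1) ^+ b * r%:Z).
exists (v + e :: V), (W ++ [seq x + (v + e) | x <- F]); split.
- by rewrite /= sV.
- by rewrite /= nV uV.
- by rewrite size_cat size_map sF sW -mulnSr !addnS.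
move=> w c; rewrite inE mem_cat => /orP[/eqP -> | wV] hc; last first.
  by rewrite hW.
have [ci|ci] := eqVneq (c i 0) ((-1) ^+ b * r%:Z).
  by rewrite (map_f (fun x => x + (v + e))) ?orbT // hF.
rewrite [v + e]addrC addrA hW //; apply/vec_heightP => j.
have hcj := vec_heightP _ _ hc j; rewrite !mxE eqxx andbT.
by case: (eqVneq j i) => [->|_] in hcj *; case: b ci {nV e sF hF} => /=; lia.
Qed.

(** Take [V] to represent all |det A| classes. The sums s + v are pairwise distinct, since the class
    of s + v determines v, and they all lie in Box + V. *)
Lemma lattice_points_upper n r (A : 'M[int]_n.+1) (S : seq 'cV[int]_n.+1) :
  \det A != 0 -> uniq S ->
  (forall x, x \in S -> (vec_height x <= r)%N /\ exists c, x = A *m c) ->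
  (size S * `|\det A| <= r.*2.+1 ^ n * (r.*2 + `|\det A|))%N.
Proof.
move=> detA uS hS; have [G [phi [cG phiE surj]]] := column_lattice_quotient detA.
have D0 : (0 < `|\det A|)%N by rewrite absz_gt0.
have phiD x y z : phi x = phi y -> phi (x + z) = phi (y + z).
  by move=> /phiE e; apply/phiE; rewrite opprD addrACA subrr addr0.
have := connected_representatives r phiD surj (k := `|\det A|.-1).
rewrite cG prednK // => /(_ (leqnn _))[V [W [sV uV sW hW]]].
rewrite -sW -sV -(size_allpairs (fun s v => s + v)).
have uV' := map_uniq uV.
apply: uniq_leq_size; last first.
  by move=> _ /allpairsP[[s v] /= [sS vV ->]]; have [hs _] := hS _ sS; apply: hW.
apply: allpairs_uniq => // -[s v] [s' v'] /allpairsP[p [p1 p2 [-> ->]]]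
  /allpairsP[q [q1 q2 [-> ->]]] /= e.
have pq : p.2 = q.2.
  apply: (map_uniq_inj uV) => //.
  have [_ [c hc]] := hS _ p1; have [_ [c' hc']] := hS _ q1.
  apply/phiE; exists (c' - c); rewrite mulmxBr -hc -hc'.
  by apply/eqP; rewrite subr_eq addrAC eq_sym subr_eq -e addrC.
by rewrite pq in e *; rewrite (addIr _ e).
Qed.

(** * Minors of maximal absolute value *)

Lemma det_rowsub_noninj (R : comPzRingType) N J (X : 'M[R]_(N, J))
    (f : 'I_J -> 'I_N) : ~ injective f -> \det (rowsub f X) = 0.
Proof.
move=> /existsNP[i /existsNP[j /not_implyP[eij /eqP nij]]].
by apply: (determinant_alternate nij) => k; rewrite !mxE eij.
Qed.

(** A repeated row gives determinant 0, and reordering rows changes only the sign, so arbitrary maps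
    of row indices may replace subsets. *)
Lemma absz_det_rowsub_le N J (X : 'M[int]_(N, J)) (f : 'I_J -> 'I_N) :
  (`|\det (rowsub f X)| <= basis_height X)%N.
Proof.
have [f_inj|/det_rowsub_noninj->//] := pselect (injective f).
have cI : #|[set f k | k : 'I_J]%SET| == J by rewrite card_imset // card_ord.
pose I : card_set N J := exist (fun I : {set 'I_N} => #|I| == J) _ cI.
have fI k : f k \in [set f k | k : 'I_J]%SET by apply: imset_f.
pose s0 k := cast_ord (eqP (valP I)) (enum_rank_in (fI k) (f k)).
have s0E k : enum_val (cast_ord (esym (eqP (valP I))) (s0 k)) = f k.
  by rewrite cast_ordK enum_rankK_in.
have s0_inj : injective s0 by move=> i j e; apply: f_inj; rewrite -!s0E e.
have -> : rowsub f X = row_perm (perm s0_inj) (row_minor X I).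
  by apply/matrixP => i j; rewrite !mxE permE s0E.
rewrite row_permE det_mulmx det_perm abszM abszX /= exp1n mul1n.
exact: (leq_bigmax I).
Qed.

(** The Gram matrix is nonsingular because v X^T X v^T is a sum of squares; hence [X] has rank [J]
    over the rationals and contains [J] independent rows. *)
Lemma exists_nonzero_minor N J (X : 'M[int]_(N, J)) :
  (forall c : 'cV[int]_J, X *m c = 0 -> c = 0) ->
  exists f, \det (rowsub f X) != 0.
Proof.
move=> Xinj; have gram0 : \det (X^T *m X) != 0.
  apply/negP => /det0P[v v0 vX]; case/negP: v0; apply/eqP.
  apply: trmx_inj; rewrite trmx0; apply: Xinj.
  have : (X *m v^T)^T *m (X *m v^T) = 0.
    by rewrite trmx_mul trmxK mulmxA -(mulmxA v) vX mul0mx.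
  move=> /matrixP/(_ 0 0); rewrite !mxE => /eqP.
  under eq_bigr do rewrite mxE -expr2.
  rewrite psumr_eq0 => [|i _]; last exact: sqr_ge0.
  move=> /allP h; apply/colP => i; rewrite [RHS]mxE; apply/eqP.
  by rewrite -sqrf_eq0; apply: h; rewrite mem_index_enum.
pose Xq : 'M[rat]_(N, J) := map_mx intr X.
have fullX : row_full Xq.
  apply/row_fullP; exists (invmx (Xq^T *m Xq) *m Xq^T).
  rewrite -mulmxA mulVmx // unitmxE unitfE /Xq map_trmx -map_mxM det_map_mx.
  by rewrite intr_eq0.
exists (fullrankfun fullX).
have := fullrowsub_unit fullX.
by rewrite unitmxE unitfE -map_mxsub det_map_mx intr_eq0.
Qed.

(* Cramer's rule: the coefficients of [row r X] on the rows of the maximal minor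
   are ratios of minors of X, hence at most 1 in absolute value. *)
Lemma maximal_minor N J (X : 'M[int]_(N, J)) :
  (forall c : 'cV[int]_J, X *m c = 0 -> c = 0) ->
  exists f : 'I_J -> 'I_N, let XI := rowsub f X in
  [/\ \det XI != 0, `|\det XI|%N = basis_height X
    & forall c h, (vec_height (XI *m c) <= h)%N ->
                  (vec_height (X *m c) <= J * h)%N].
Proof.
move=> /exists_nonzero_minor[g0 dg0].
(* Maximising over all maps, injective or not, covers the row replacement in [adjE], which may
   repeat a row. *)
pose f := [arg max_(g > finfun g0 : {ffun 'I_J -> 'I_N}) `|\det (rowsub g X)|%N].
have fmax (g : 'I_J -> 'I_N) :
    (`|\det (rowsub g X)| <= `|\det (rowsub f X)|)%N.
  rewrite /f; case: arg_maxnP => // k _ /(_ (finfun g) isT).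
  by rewrite (eq_rowsub _ (ffunE g)).
have df0 : \det (rowsub f X) != 0.
  by rewrite -absz_gt0; apply: leq_trans (fmax g0); rewrite absz_gt0.
exists f; split => //.
- apply/eqP; rewrite eqn_leq absz_det_rowsub_le /=.
  by apply/bigmax_leqP => I _; apply: fmax.
move=> c h /vec_heightP hy; set XI := rowsub f X in df0 hy *.
apply/vec_heightP => r.
have adjE j : `|(row r X *m \adj XI) 0 j| <= `|\det XI|.
  (* Replacing row [j] of the minor by row [r] of [X] turns the adjugate entry into a determinant,
     expanded along row [j]. *)
  pose g k := if k == j then r else f k.
  have -> : (row r X *m \adj XI) 0 j = \det (rowsub g X).
    rewrite (expand_det_row _ j) mxE; apply: eq_bigr => k _.
    rewrite !mxE /g eqxx; congr (_ * _); congr (_ * \det _).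
    by apply/matrixP => a b; rewrite !mxE eq_sym (negPf (neq_lift _ _)).
  by rewrite -!abszE lez_nat.
have D0 : 0 < `|\det XI| by rewrite normr_gt0.
rewrite -(ler_pM2l D0) -normrM.
have -> : \det XI * (X *m c) r 0 =
    \sum_j (row r X *m \adj XI) 0 j * (XI *m c) j 0.
  have -> : \det XI * (X *m c) r 0 = (row r X *m \adj XI *m (XI *m c)) 0 0.
    rewrite mulmxA -(mulmxA _ (\adj XI)) mul_adj_mx mul_mx_scalar -scalemxAl.
    by rewrite -row_mul !mxE.
  by rewrite mxE.
apply: le_trans (ler_norm_sum _ _ _) _.
apply: (@le_trans _ _ (\sum_(j < J) `|\det XI| * h%:Z)).
  by apply: ler_sum => j _; rewrite normrM ler_pM.
by rewrite sumr_const card_ord -mulr_natr -mulrA PoszM [h%:Z * _]mulrC natz.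
Qed.

(** * Lower bound for lattice points in a box *)

Lemma symmetric_residue (n : nat) (z : int) : (0 < n)%N ->
  exists w : int, `|w| <= n./2%:Z /\ (n%:Z %| z - w)%Z.
Proof.
(* The shift centres the residues: they run from -floor(n/2) to n - 1 - floor(n/2), which is at most
   floor(n/2). *)
move=> n0; exists (((z + n./2%:Z)%R %% n%:Z)%Z - n./2%:Z); split.
  have n0' : n%:Z != 0 by lia.
  have := modz_ge0 (z + n./2%:Z) n0'; have := @ltz_pmod (z + n./2%:Z) n%:Z n0.
  have := odd_double_half n; lia.
have -> : z - (((z + n./2%:Z)%R %% n%:Z)%Z - n./2%:Z) =
    ((z + n./2%:Z)%R %/ n%:Z)%Z * n%:Z.
  by have := divz_eq (z + n./2%:Z) n%:Z; lia.
exact: dvdz_mull.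
Qed.

(* Some coset of the lattice contains at least n^J / |det A| points of
   [0, n)^J; since n Z^J is contained in the lattice, the differences with one
   of them can be reduced modulo n to a box centred at 0. *)
Lemma lattice_points_lower J (A : 'M[int]_J) n :
  \det A != 0 -> (0 < n)%N -> (`|\det A| %| n)%N ->
  exists S : seq 'cV[int]_J,
    [/\ uniq S,
        forall x, x \in S -> (vec_height x <= n./2)%N /\ exists c, x = A *m c
      & (n ^ J <= `|\det A| * size S)%N].
Proof.
move=> detA n0 dvdn; have [G [phi [cG phiE _]]] := column_lattice_quotient detA.
pose F := {ffun 'I_J -> 'I_n}.
pose vec (f : F) : 'cV[int]_J := \col_i (f i : nat)%:Z.
pose fib g := [pred f : F | phi (vec f) == g].
have cF : #|F| = (n ^ J)%N by rewrite card_ffun !card_ord.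
(* Pigeonhole: some class contains at least the average number of points of the cube. *)
have [g hg] : exists g, (n ^ J <= `|\det A| * #|fib g|)%N.
  apply: contrapT => no.
  have lt g : (`|\det A| * #|fib g| < n ^ J)%N.
    by rewrite ltnNge; apply/negP => h; apply: no; exists g.
  have : (`|\det A| * \sum_g #|fib g| < `|\det A| * n ^ J)%N.
    have -> : (`|\det A| * n ^ J = \sum_(g : G) n ^ J)%N
      by rewrite sum_nat_const cG.
    rewrite big_distrr /=.
    have /card_gt0P[g0 _] : (0 < #|G|)%N by rewrite cG absz_gt0.
    rewrite [X in (X < _)%N](bigD1 g0) // [X in (_ < X)%N](bigD1 g0) //=.
    by rewrite -addSn leq_add // leq_sum // => i _; exact: ltnW.
  rewrite ltn_mul2l => /andP[_]; rewrite -cF ltnNge => /negP[].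
  under eq_bigr do rewrite -sum1_card.
  by rewrite -sum1_card (partition_big (fun f => phi (vec f)) xpredT).
have [f0 hf0] : exists f0, f0 \in fib g.
  apply/card_gt0P; case: #|fib g| hg => //; rewrite muln0 leqNgt expn_gt0 n0.
  by [].
have [res hres] := choice (fun z => @symmetric_residue n z n0).
pose red (f : F) : 'cV[int]_J := \col_i res ((f i : nat)%:Z - (f0 i : nat)%:Z).
exists [seq red f | f <- enum (fib g)]; split.
- rewrite map_inj_in_uniq; first exact: enum_uniq.
  move=> f f' _ _ /colP e; apply/ffunP => i; apply: val_inj => /=.
  have := e i; rewrite !mxE => ei.
  have [_ d1] := hres ((f i : nat)%:Z - (f0 i : nat)%:Z).
  have [_ d2] := hres ((f' i : nat)%:Z - (f0 i : nat)%:Z).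
  have : (n%:Z %| (f i : nat)%:Z - (f' i : nat)%:Z)%Z.
    have -> : (f i : nat)%:Z - (f' i : nat)%:Z =
      ((f i : nat)%:Z - (f0 i : nat)%:Z
        - res ((f i : nat)%:Z - (f0 i : nat)%:Z)) -
      ((f' i : nat)%:Z - (f0 i : nat)%:Z
        - res ((f' i : nat)%:Z - (f0 i : nat)%:Z)) by rewrite ei; ring.
    exact: rpredB.
  by rewrite -eqz_mod_dvd !modz_nat !(modn_small (ltn_ord _)) => /eqP[].
- move=> x /mapP[f]; rewrite mem_enum => ff ->; split.
    by apply/vec_heightP => i; rewrite mxE; exact: (proj1 (hres _)).
  have [c hc] : exists c, vec f - vec f0 = A *m c.
    by apply/phiE; move: ff hf0; rewrite !inE => /eqP -> /eqP ->.
  (* With n = det(A) q, the vector n w equals A adj(A) (q w), so reduction modulo [n] stays in the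
     lattice. *)
  have [q hq] : exists q : int, n%:Z = \det A * q.
    have /dvdzP[q hq] : (\det A %| n%:Z)%Z by rewrite /dvdz.
    by exists q; rewrite hq mulrC.
  have [w hw] : exists w : 'cV[int]_J, vec f - vec f0 - red f = n%:Z *: w.
    exists (\col_i ((vec f - vec f0 - red f)%R i 0%R %/ n%:Z)%Z).
    apply/colP => i; rewrite !mxE mulrC divzK //.
    exact: (proj2 (hres _)).
  exists (c - \adj A *m (q *: w)).
  rewrite mulmxBr mulmxA mul_mx_adj mul_scalar_mx scalerA -hq -hw -hc.
  by rewrite opprB addrC subrK.
- by rewrite size_map -cardE.
Qed.

(** * Transfer to lattices of arbitrary rank *)

Lemma basis_mulmx N J (L : set 'cV[int]_N) (X : 'M[int]_(N, J)) :
  is_subgroup L -> is_basis L X ->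
  (forall x, L x <-> exists c, x = X *m c) /\
  (forall c : 'cV[int]_J, X *m c = 0 -> c = 0).
Proof.
move=> [L0 LB] [colX uniX].
have sumE (c : 'cV[int]_J) : \sum_j c j 0 *: col j X = X *m c.
  apply/colP => i; rewrite summxE mxE; apply: eq_bigr => j _.
  by rewrite !mxE mulrC.
have LN x : L x -> L (- x) by move=> Lx; rewrite -sub0r; apply: LB.
have LD x y : L x -> L y -> L (x + y).
  by move=> Lx Ly; rewrite -[y]opprK; apply: LB => //; apply: LN.
split=> [x|c Xc0].
  split=> [/uniX[c [-> _]]|[c ->]]; first by exists c.
  rewrite -sumE; elim/big_ind: _ => // j _.
  have nat_mul m : L (col j X *+ m).
    by elim: m => // m IH; rewrite mulrS; apply: LD.
  rewrite -[c j 0]intz scaler_int.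
  by case: (c j 0) => m; [exact: nat_mul | exact/LN/nat_mul].
have [d [_ du]] := uniX _ L0.
by rewrite -(du c) ?sumE // (du 0) // sumE mulmx0.
Qed.

(** A basis exists, so [xget] returns one; its maximal minor realises the height and reduces
    counting in [L] to the full-rank lattice spanned by [XI]. *)
Lemma lattice_height_minor N J (L : set 'cV[int]_N) : is_lattice J L ->
  exists (X : 'M[int]_(N, J)) (f : 'I_J -> 'I_N), let XI := rowsub f X in
  [/\ \det XI != 0, `|\det XI|%N = lattice_height J L,
      forall x, L x <-> exists c, x = X *m c
    & forall c h, (vec_height (XI *m c) <= h)%N ->
                  (vec_height (X *m c) <= J * h)%N].
Proof.
move=> [sL /(xgetPex 0)]; rewrite /lattice_height.
set X := xget _ _ => /(basis_mulmx sL)[LE /maximal_minor[f [d0 dE hX]]].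
by exists X, f; split.
Qed.

Lemma lattice_height_gt0 N J (L : set 'cV[int]_N) : is_lattice J L ->
  (0 < lattice_height J L)%N.
Proof.
by move=> /lattice_height_minor[X [f [d0 <- _ _]]]; rewrite absz_gt0.
Qed.

(** Projection on the rows [f] is injective on [L] because the minor is nonsingular, and it does not
    increase heights. *)
Lemma lattice_count_upper N n (L : set 'cV[int]_N) r (S : seq 'cV[int]_N) :
  is_lattice n.+1 L -> uniq S ->
  (forall x, x \in S -> L x /\ (vec_height x <= r)%N) ->
  (size S * lattice_height n.+1 L <=
     r.*2.+1 ^ n * (r.*2 + lattice_height n.+1 L))%N.
Proof.
move=> /lattice_height_minor[X [f [d0 <- LE _]]] uS hS.
rewrite -(size_map (rowsub f)); apply: lattice_points_upper => //.
  rewrite map_inj_in_uniq // => x y xS yS.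
  have [/LE[c ->] _] := hS _ xS; have [/LE[d ->] _] := hS _ yS.
  rewrite -!mul_rowsub_mx => /(congr1 (mulmx (\adj (rowsub f X)))).
  rewrite !mulmxA mul_adj_mx !mul_scalar_mx => /matrixP e; congr (_ *m _).
  by apply/matrixP => i j; have := e i j; rewrite !mxE => /(mulfI d0).
move=> y /mapP[x xS ->]; have [/LE[c xE] /vec_heightP hx] := hS _ xS.
split; first by apply/vec_heightP => i; rewrite mxE.
by exists c; rewrite xE -mul_rowsub_mx.
Qed.

(** Points XI c of the full-rank lattice lift to X c, at the cost of the factor [J] from Cramer's
    rule. *)
Lemma lattice_count_lower N J (L : set 'cV[int]_N) n :
  is_lattice J L -> (0 < n)%N -> (lattice_height J L %| n)%N ->
  exists S : seq 'cV[int]_N,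
    [/\ uniq S, forall x, x \in S -> L x /\ (vec_height x <= J * n./2)%N
      & (n ^ J <= lattice_height J L * size S)%N].
Proof.
move=> /lattice_height_minor[X [f [d0 <- LE hX]]] n0 dvd.
have [S [uS hS cS]] := lattice_points_lower d0 n0 dvd.
have /choice[pre hpre] : forall x : 'cV[int]_J, exists c : 'cV[int]_J,
    x \in S -> x = rowsub f X *m c.
  move=> x; have [/hS[_ [c xE]]|] := boolP (x \in S); first by exists c.
  by exists 0.
exists [seq X *m pre x | x <- S]; split; last by rewrite size_map.
  rewrite map_inj_in_uniq // => x y xS yS /(congr1 (rowsub f)).
  by rewrite -!mul_rowsub_mx -!hpre.
move=> y /mapP[x xS ->]; split; first by apply/LE; exists (pre x).
by apply: hX; rewrite -hpre //; case: (hS _ xS).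
Qed.

(** * Covering argument and choice of parameters *)

Lemma size_le_sum_count (I : finType) (U : Type) (P : I -> pred U) (S : seq U) :
  all (fun x => [exists i, P i x]) S ->
  (size S <= \sum_(i : I) count (P i) S)%N.
Proof.
elim: S => [|x S IH] //= /andP[/existsP[i Pi] /IH{}IH].
rewrite big_split /= -add1n leq_add //.
by rewrite (bigD1 i) //= Pi.
Qed.

(** Since t + 1 >= 1, the exponent l - 1 may be raised to the common value [j], so that the bounds
    for different ranks can be added. *)
Lemma lattice_count_upper_real (R : realType) N j l (L : set 'cV[int]_N) r
    (S : seq 'cV[int]_N) (t : R) :
  is_lattice l L -> (1 <= l <= j.+1)%N -> uniq S ->
  (forall x, x \in S -> L x /\ (vec_height x <= r)%N) -> r.*2%:R <= t ->
  (size S)%:R <= (t + 1) ^+ j * (t / (lattice_height l L)%:R + 1).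
Proof.
case: l => // l latL /= lj uS hS rt.
have h0 : 0 < (lattice_height l.+1 L)%:R :> R.
  by rewrite ltr0n lattice_height_gt0.
have := lattice_count_upper latL uS hS.
rewrite -(ler_nat R) !natrM natrX natrD -natr1 => cnt.
have t0 : 0 <= t by apply: le_trans rt.
rewrite -(ler_pM2r h0) -mulrA mulrDl mul1r divfK ?gt_eqF //.
apply: le_trans cnt _; apply: ler_pM => //; rewrite ?lerD2r //.
- by rewrite exprn_ge0 // addr_ge0.
- by rewrite addr_ge0 // ltW.
- apply: (@le_trans _ _ ((t + 1) ^+ l)).
    by rewrite lerXn2r ?nnegrE ?addr_ge0 // lerD2r.
  by rewrite ler_weXn2l // lerDr.
Qed.

(** Here [D] stands for H(Omega), [s] for the sum of the 1/H(Lambda_i), [m] for M and [e] for the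
    number of points. Cancelling [t ^+ j] leaves t^2 <= B (t s + m), whereas [t] and t - B s both
    exceed sqrt(B m), so t (t - B s) > B m. *)
Lemma point_counts_incompatible (R : realType) (j n : nat) (D s m e : R) :
  let t := j.+2%:R * n%:R in
  let B := (3%:R / 2%:R) ^+ j * j.+2%:R ^+ j.+2 * D in
  0 < D -> 0 <= s -> 0 < m -> (0 < n)%N -> B * s + Num.sqrt (B * m) < t ->
  n%:R ^+ j.+2 <= D * e -> e <= (t + 1) ^+ j * (t * s + m) -> False.
Proof.
move=> t B D0 s0 m0 n0 ht lo up.
have J0 : 0 < j.+2%:R :> R by rewrite ltr0n.
have c0 : 0 < (3%:R / 2%:R) ^+ j :> R by rewrite exprn_gt0 // divr_gt0.
have B0 : 0 < B by rewrite /B mulr_gt0 // mulr_gt0 // exprn_gt0.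
(* This gives t + 1 <= (3/2) t, the source of the powers of 3/2. *)
have t2 : 2 <= t by rewrite /t -natrM ler_nat; lia.
have t0 : 0 < t by lra.
have tsm : 0 <= t * s + m by rewrite addr_ge0 ?mulr_ge0 // ltW.
have te : t ^+ j.+2 <= B * t ^+ j * (t * s + m).
  rewrite {1}/t exprMn.
  apply: (@le_trans _ _ (j.+2%:R ^+ j.+2 * (D * e))).
    by rewrite ler_pM2l // exprn_gt0.
  have -> : B * t ^+ j * (t * s + m) =
    j.+2%:R ^+ j.+2 * (D * ((3%:R / 2%:R * t) ^+ j * (t * s + m))).
    by rewrite /B [(3%:R / 2%:R * t) ^+ j]exprMn; clearbody t; ring.
  rewrite !ler_pM2l ?exprn_gt0 //; apply: le_trans up _.
  by rewrite ler_wpM2r // lerXn2r ?nnegrE; lra.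
have tt : t * t <= B * (t * s + m).
  have tj : 0 < t ^+ j by rewrite exprn_gt0.
  by rewrite -(ler_pM2l tj); move: te; rewrite !exprSr; lra.
have q0 : 0 < Num.sqrt (B * m) by rewrite sqrtr_gt0 mulr_gt0.
have qq : Num.sqrt (B * m) * Num.sqrt (B * m) = B * m.
  by rewrite -expr2 sqr_sqrtr // mulr_ge0 // ltW.
have Bs : 0 <= B * s by rewrite mulr_ge0 // ltW.
move: (Num.sqrt _) q0 qq ht => q q0 qq ht.
have : q * q < t * (t - B * s) by rewrite ltr_pM //; lra.
rewrite qq; lra.
Qed.

Theorem theorem1p1 (R : realType) (N J M : nat)
    (hJ : (1 <= J <= N)%N) (hM : (1 <= M)%N)
    (Omega : set 'cV[int]_N) (hOmega : is_lattice J Omega)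
    (Lambda : 'I_M -> set 'cV[int]_N) (l : 'I_M -> nat)
    (hLambda : forall i, is_lattice (l i) (Lambda i))
    (hLambda0 : forall i, Lambda i <> [set 0])
    (hsub : forall i, Lambda i `<=` Omega)
    (hl : forall i, (1 <= l i <= J - 1)%N) :
  exists2 x : 'cV[int]_N,
    (Omega `\` \bigcup_(i in [set: 'I_M]) Lambda i) x &
    (vec_height x)%:R <=
      ((3%:R / 2%:R) ^+ (J - 1) * J%:R ^+ J *
         (\sum_(i < M) ((lattice_height (l i) (Lambda i))%:R)^-1
          + Num.sqrt M%:R)
       + J%:R) * (lattice_height J Omega)%:R :> R.
Proof.
case: M hM Lambda l hLambda hLambda0 hsub hl => // M _ Lambda l hLambda _ _ hl.
(* Rank 1 is excluded by the rank condition on [Lambda ord0]; from here on J = j + 2. *)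
case: J hJ Omega hOmega hl => [|[|j]] // _ Omega hOmega hl.
  by have := hl ord0; lia.
have H0 := lattice_height_gt0 hOmega.
set H := lattice_height _ Omega in H0 *.
set s := \sum_(i < _) _.
have s0 : 0 <= s by apply: sumr_ge0 => i _; rewrite invr_ge0.
have D0 : 0 < H%:R :> R by rewrite ltr0n.
have J0 : 0 < j.+2%:R :> R by rewrite ltr0n.
pose C : R := (3%:R / 2%:R) ^+ j * j.+2%:R ^+ j.+2.
pose B := C * H%:R.
have C1 : 1 <= C.
  by rewrite mulr_ege1 // exprn_ege1 // ?ler1n //; lra.
have H1 : 1 <= H%:R :> R by rewrite ler1n.
have B1 : 1 <= B by rewrite mulr_ege1.
have E0 : 0 <= B * s + Num.sqrt (B * M.+1%:R).
  by rewrite addr_ge0 ?sqrtr_ge0 // mulr_ge0 //; lra.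
have JH0 : 0 < j.+2%:R * H%:R :> R by rewrite mulr_gt0.
(* The least multiple [n] of [H] for which J n exceeds the threshold; the overshoot is at most J H,
   whence the summand J in the final bound. *)
pose k := (Num.truncn ((B * s + Num.sqrt (B * M.+1%:R)) / (j.+2%:R * H%:R))).+1.
pose n := (k * H)%N.
have n0 : (0 < n)%N by rewrite muln_gt0.
have tE : j.+2%:R * n%:R = k%:R * (j.+2%:R * H%:R) :> R.
  by rewrite /n natrM; ring.
have t_gt : B * s + Num.sqrt (B * M.+1%:R) < j.+2%:R * n%:R :> R.
  by rewrite tE -ltr_pdivrMr //; exact: truncnS_gt.
have t_le : j.+2%:R * n%:R <=
    B * s + Num.sqrt (B * M.+1%:R) + j.+2%:R * H%:R :> R.
  rewrite tE /k -natr1 mulrDl mul1r lerD2r -ler_pdivlMr //.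
  by have /andP[] := truncn_itv (divr_ge0 E0 (ltW JH0)).
have [S [uS hS cS]] := lattice_count_lower hOmega n0 (dvdn_mull _ (dvdnn _)).
set r := (j.+2 * n./2)%N in hS.
have rt : r.*2%:R <= j.+2%:R * n%:R :> R.
  rewrite -natrM ler_nat /r -muln2 -mulnA leq_mul2l muln2.
  by rewrite -{2}(odd_double_half n) leq_addl.
have [x xS nx] : exists2 x, x \in S & ~ (exists i, Lambda i x).
  apply: contrapT => no.
  have cov : all (fun x => [exists i, `[<Lambda i x>]]) S.
    apply/allP => x xS; apply: contrapT => nx; apply: no; exists x => //.
    by move=> [i Li]; apply: nx; apply/existsP; exists i; apply/asboolP.
  have cnt : (size S)%:R <=
      (j.+2%:R * n%:R + 1) ^+ j * (j.+2%:R * n%:R * s + M.+1%:R) :> R.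
    have := size_le_sum_count cov; rewrite -(ler_nat R) => /le_trans; apply.
    (* Written as a sum of ones, M merges with t s into the sum of the terms t/H(Lambda_i) + 1. *)
    have -> : M.+1%:R = \sum_(i < M.+1) 1 :> R by rewrite sumr_const card_ord.
    rewrite natr_sum [_ * s]mulr_sumr -big_split mulr_sumr; apply: ler_sum => i _ /=.
    rewrite -size_filter; apply: (lattice_count_upper_real (hLambda i)) rt => //.
    - exact: filter_uniq.
    - move=> x; rewrite mem_filter => /andP[/asboolP Lx xS]; split=> //.
      by case: (hS _ xS).
  apply: (point_counts_incompatible (j := j) (D := H%:R)) cnt => //.
  by rewrite -natrX -natrM ler_nat.
have [Ox hx] := hS _ xS.
exists x; first by split=> // -[i _ Li]; apply: nx; exists i.
apply: (@le_trans _ _ r%:R); first by rewrite ler_nat.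
apply: (@le_trans _ _ (j.+2%:R * n%:R)).
  by apply: le_trans rt; rewrite ler_nat -addnn leq_addr.
apply: le_trans t_le _.
(* The stated bound has one more factor 3/2 than [C]; being at least 1, it is absorbed in the last
   inequality. *)
have CE : (3%:R / 2%:R) ^+ (j.+2 - 1) * j.+2%:R ^+ j.+2 = 3%:R / 2%:R * C.
  by rewrite subn1 /= (exprS _ j) -mulrA /C.
rewrite CE.
(* As B >= 1, its square root is at most [B], which makes the bound linear in H(Omega). *)
have sqB : Num.sqrt (B * M.+1%:R) <= B * Num.sqrt M.+1%:R.
  rewrite sqrtrM; last by lra.
  rewrite ler_wpM2r ?sqrtr_ge0 // -{2}(sqr_sqrtr (_ : 0 <= B)); last by lra.
  by rewrite ler_eXnr // -sqrtr1 ler_wsqrtr.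
have -> : (3%:R / 2%:R * C * (s + Num.sqrt M.+1%:R) + j.+2%:R) * H%:R =
    3%:R / 2%:R * (B * s + B * Num.sqrt M.+1%:R) + j.+2%:R * H%:R.
  by rewrite /B; clearbody s C; ring.
have : 0 <= B * s by rewrite mulr_ge0 //; lra.
have := sqrtr_ge0 (B * M.+1%:R).
lra.
Qed.
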